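(* Let $(r_k)_{k\in\mathbb{N}_0}$ be a real-valued sequence satisfying $$r_{k+2}=r_1r_{k+1}-r_k\qquad\text{for all }k\ge0,$$ with $r_0,r_1\in\mathbb{R}$. Let $(s_k)_{k\in\mathbb{N}_0}$ be the sequence with initial values $s_0=2$, $s_1=r_1$ satisfying $s_{k+2}=s_1s_{k+1}-s_k$ for all $k\ge0$. Then for all $p\ge0$ and $k\ge0$, $$r_{k+2p}=s_p\,r_{k+p}-r_k.$$
   Context: $\mathbb{N}_0$ denotes the set of non-negative integers; $p$ and $k$ are integers. *)

(* Defs.v *)
From Stdlib Require Export Reals.

(* Main.v *)
(** Strong two-step induction on [p]: expanding [s (p + 2)] turns
    [s (p + 2) * r (k + p + 2)] into instances of the claim at
    [(p + 1, k + 1)] and [(p, k + 2)], and the recurrence of [r] collects them. *)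
Require Import Defs.
From Stdlib Require Import Reals Lra Lia.
Open Scope R_scope.

Theorem theorem5p2 (r s : nat -> R)
  (hr : forall k : nat, r (k + 2)%nat = r 1%nat * r (k + 1)%nat - r k)
  (hs0 : s 0%nat = 2)
  (hs1 : s 1%nat = r 1%nat)
  (hs : forall k : nat, s (k + 2)%nat = s 1%nat * s (k + 1)%nat - s k) :
  forall p k : nat, r (k + 2 * p)%nat = s p * r (k + p)%nat - r k.
Proof.
  (* Pairing the claims at [p] and [p + 1] makes plain induction two-step; [k] stays quantified
     inside so that both hypotheses can be used at shifted indices. *)
  enough (H : forall p,
    (forall k, r (k + 2 * p)%nat = s p * r (k + p)%nat - r k) /\
    (forall k, r (k + 2 * (p + 1))%nat = s (p + 1)%nat * r (k + (p + 1))%nat - r k))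
    by (intro p; apply H).
  induction p as [|p [IH0 IH1]]; split; intro k.
  - rewrite hs0; replace (k + 2 * 0)%nat with k by lia.
    replace (k + 0)%nat with k by lia; lra.
  (* For [p = 1] the claim is the recurrence of [r] itself, because [s 1 = r 1]. *)
  - change (0 + 1)%nat with 1%nat; rewrite hs1; apply hr.
  - replace (S p) with (p + 1)%nat by lia; apply IH1.
  - specialize (IH0 (k + 2)%nat); specialize (IH1 (k + 1)%nat).
    pose proof (hr (k + 2 * p + 2)%nat) as Htop.
    pose proof (hr k) as Hbot.
    replace (S p + 1)%nat with (p + 2)%nat by lia.
    rewrite hs, hs1.
    replace (k + 2 * (p + 2))%nat with (k + 2 * p + 2 + 2)%nat by lia.
    replace (k + (p + 2))%nat with (k + p + 2)%nat by lia.
    replace (k + 2 + 2 * p)%nat with (k + 2 * p + 2)%nat in IH0 by lia.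
    replace (k + 2 + p)%nat with (k + p + 2)%nat in IH0 by lia.
    replace (k + 1 + 2 * (p + 1))%nat with (k + 2 * p + 2 + 1)%nat in IH1 by lia.
    replace (k + 1 + (p + 1))%nat with (k + p + 2)%nat in IH1 by lia.
    (* The leftover [- r 1 * r (k + 1)] from [IH1] cancels against [r (k + 2)] from [IH0] expanded
       by [Hbot], leaving [- r k]. *)
    rewrite Htop, IH1, IH0, Hbot; ring.
Qed.
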